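(* Suppose the best-reply (BR) dynamic converges to the unique Nash equilibrium in the sense that $\sum_{j\neq i}|J_{ij}^{BR(t)}|<1$ for all $i$ (and all iterations $t$). Then the Jacobi-play (JP) dynamic also converges to it whenever $$0<\kappa_i^{(t)}<\frac{2}{1+\sum_{j\neq i}|J_{ij}^{BR(t)}|}\qquad\text{for all } i .$$
   Context: $\mathcal G$ is an $N$-player game with strategy spaces $S_i=[\beta_i^{min},\beta_i^{max}]$ and utilities $U_i(\beta_i,\boldsymbol\beta_{-i})$ that are continuous and concave in $\beta_i$. The best response is $BR_i(\boldsymbol\beta_{-i})=\arg\max_{\beta_i\in S_i}U_i(\beta_i,\boldsymbol\beta_{-i})$ (single-valued and differentiable). The JP dynamic is the parallel update $$\beta_i^{(t)}=(1-\kappa_i^{(t)})\beta_i^{(t-1)}+\kappa_i^{(t)}BR_i(\boldsymbol\beta_{-i}^{(t-1)}),\quad \forall i,$$ with smoothing parameters $\kappa_i^{(t)}>0$; the BR dynamic is the special case $\kappa_i^{(t)}=1$ for all $i,t$. $J_{ij}^{BR(t)}=\frac{\partial BR_i(\boldsymbol\beta_{-i}^{(t-1)})}{\partial\beta_j}$ for $j\ne i$ and $J_{ii}^{BR(t)}=0$. Convergence is understood by the contraction criterion: the iteration $\boldsymbol\beta^{(t)}=M(\boldsymbol\beta^{(t-1)})$ is contracting if the Jacobian $T^{(t)}=[\partial M_i/\partial\beta_j]$ satisfies $\|T^{(t)}\|_\infty<1$. *)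

(* Defs.v *)
From HB Require Import structures.
From mathcomp Require Import all_boot all_order all_algebra.
From mathcomp Require Import all_classical all_reals all_analysis.

Set Implicit Arguments.
Unset Strict Implicit.
Unset Printing Implicit Defensive.

Import Order.TTheory GRing.Theory Num.Theory.
Import numFieldNormedType.Exports.

Local Open Scope classical_set_scope.
Local Open Scope ring_scope.

Section Calculus.
Context {R : realType} {N : nat}.
Implicit Types (D : set 'rV[R]_N) (f : 'rV[R]_N -> R) (x : 'rV[R]_N).

(* Derivatives are taken relative to a domain D, because profiles may lie on
   the boundary of the strategy space and maps are meaningful only on it. *)
Definition differentiable_in D f x : Prop :=
  exists L : {linear 'rV[R]_N -> R^o}, forall e : R, 0 < e ->
    \forall y \near within D (nbhs x),
      `|f y - f x - L (y - x)| <= e * `|y - x|.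

Definition partial_in D f x (j : 'I_N) : R :=
  lim ((fun h : R => h^-1 * (f (x + h *: delta_mx 0 j) - f x)) @
         within [set h | D (x + h *: delta_mx 0 j)] 0^').

Definition jacobian_in D (M : 'rV[R]_N -> 'rV[R]_N) x : 'M[R]_N :=
  \matrix_(i, j) partial_in D (fun y => M y 0 i) x j.

(* The operator norm induced by the sup norm on column vectors; it differs
   from the library's entrywise norm on matrices. *)
Definition norm_inf (T : 'M[R]_N) : R :=
  \big[Num.max/0]_(i < N) \sum_(j < N) `|T i j|.

(* The limit in partial_in is a default value when it does not exist, hence
   the differentiability clause. *)
Definition contracting_at D (M : 'rV[R]_N -> 'rV[R]_N) x : Prop :=
  (forall i, differentiable_in D (fun y => M y 0 i) x) /\
  norm_inf (jacobian_in D M x) < 1.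

Definition deviate x (i : 'I_N) (b : R) : 'rV[R]_N :=
  \row_j (if j == i then b else x 0 j).

End Calculus.

(* The utility of a player takes a whole profile; U_i (b, x_{-i}) is
   [utility i (deviate x i b)]. *)
Record game (R : realType) (N : nat) := Game {
  smin : 'I_N -> R;
  smax : 'I_N -> R;
  utility : 'I_N -> 'rV[R]_N -> R }.

Section Games.
Context {R : realType} {N : nat} (G : game R N).
Implicit Types (x : 'rV[R]_N) (i j : 'I_N).

Definition strategies i : set R := [set` `[smin G i, smax G i]].

Definition profiles : set 'rV[R]_N := [set x | forall i, strategies i (x 0 i)].

(* Strict inequality: on a one-point interval there is no derivative. *)
Definition strategies_nondegenerate : Prop := forall i, smin G i < smax G i.

Definition own_continuous : Prop := forall i x, profiles x ->
  {within strategies i, continuous (fun b => utility G i (deviate x i b))}.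

Definition own_concave : Prop := forall i x, profiles x ->
  forall a b l : R, strategies i a -> strategies i b -> 0 <= l <= 1 ->
  l * utility G i (deviate x i a) + (1 - l) * utility G i (deviate x i b)
    <= utility G i (deviate x i (l * a + (1 - l) * b)).

Definition best_responses i x : set R :=
  [set b | strategies i b /\ forall a, strategies i a ->
     utility G i (deviate x i a) <= utility G i (deviate x i b)].

Definition BR_single_valued : Prop := forall i x, profiles x ->
  exists b, best_responses i x = [set b].

Definition BR i x : R := get (best_responses i x).

Definition BR_differentiable : Prop := forall i x, profiles x ->
  differentiable_in profiles (BR i) x.

Definition nash x : Prop :=
  profiles x /\ forall i a, strategies i a ->
    utility G i (deviate x i a) <= utility G i x.

Definition unique_nash x : Prop := nash x /\ forall y, nash y -> y = x.

Definition JBR x : 'M[R]_N :=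
  \matrix_(i, j) if j == i then 0 else partial_in profiles (BR i) x j.

Definition JP_map (kappa : 'I_N -> R) x : 'rV[R]_N :=
  \row_i ((1 - kappa i) * x 0 i + kappa i * BR i x).

(* With kappa i > 1 the update may overshoot the strategy interval; being a
   sequence of strategy profiles is part of being a play. *)
Definition JP_play (kappa : nat -> 'I_N -> R) (beta : nat -> 'rV[R]_N) : Prop :=
  (forall t, profiles (beta t)) /\
  forall t, beta t.+1 = JP_map (kappa t.+1) (beta t).

(* Convergence of the iteration beta^(t) = M^(t) (beta^(t-1)), t >= 1, in the
   sense of the contraction criterion: the limit point is stationary and every
   step is contracting. It does not assert topological convergence, which
   would fail for instance for summable smoothing parameters. *)
Definition converges_by_contraction (M : nat -> 'rV[R]_N -> 'rV[R]_N)
    (beta : nat -> 'rV[R]_N) x : Prop :=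
  (forall t, M t.+1 x = x) /\
  forall t, contracting_at profiles (M t.+1) (beta t).

End Games.

(* Main.v *)
(* Player i's best reply ignores beta_i, so row i of the Jacobian of the JP step
   has diagonal entry 1 - kappa_i and off-diagonal entries kappa_i J_ij. With
   s = sum_(j != i) |J_ij| < 1, its absolute row sum is |1 - kappa_i| + kappa_i s:
   for kappa_i <= 1 this is below 1 because s < 1, and for kappa_i > 1 it is
   below 1 exactly when kappa_i < 2 / (1 + s). *)

Require Import Defs.
From HB Require Import structures.
From mathcomp Require Import all_boot all_order all_algebra.
From mathcomp Require Import all_classical all_reals all_analysis.
From mathcomp Require Import ring lra.

Import Order.TTheory GRing.Theory Num.Theory.
Import numFieldNormedType.Exports.

Local Open Scope classical_set_scope.
Local Open Scope ring_scope.

(** The condition inside [differentiable_in] with its witness [L] exposed, so that partial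
    derivatives can be read off as values of [L]. *)
Definition has_derivative_in {R : realType} {N : nat} (D : set 'rV[R]_N)
    (f : 'rV[R]_N -> R) (x : 'rV[R]_N) (L : {linear 'rV[R]_N -> R^o}) : Prop :=
  forall e : R, 0 < e ->
    \forall y \near within D (nbhs x), `|f y - f x - L (y - x)| <= e * `|y - x|.

Lemma has_derivative_in_cvg {R : realType} {N : nat} (D : set 'rV[R]_N)
    (f : 'rV[R]_N -> R) (x : 'rV[R]_N) (L : {linear 'rV[R]_N -> R^o})
    (j : 'I_N) :
  has_derivative_in D f x L ->
  ((fun h : R => h^-1 * (f (x + h *: delta_mx 0 j) - f x)) @
     within [set h | D (x + h *: delta_mx 0 j)] 0^') --> (L (delta_mx 0 j) : R).
Proof.
move=> dfL; set d : 'rV[R]_N := delta_mx 0 j.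
apply/cvgrPdist_le => e e0.
(* Tolerance [e / (1 + |d|)]: on the line the error is at most that times [|h| * |d|], hence at most
   [e] after division by [|h|]. The added 1 makes the denominator positive. *)
have c0 : 0 < 1 + `|d| by rewrite ltr_pwDl.
have cvg_line : (fun h : R => x + h *: d) @ (0 : R) --> x.
  have : (fun h : R => x + h *: d) @ (0 : R) --> x + 0 *: d.
    by apply: cvgD; [exact: cvg_cst | apply: cvgZr_tmp; exact: cvg_id].
  by rewrite scale0r addr0.
have near_line := cvg_line _ (dfL (e / (1 + `|d|)) (divr_gt0 e0 c0)).
apply: (@filterS _ (nbhs (0 : R)) _ _ _ _ near_line) => h bound h0 Dh.
move: (bound Dh) => {bound} /=.
rewrite [x + _ - x]addrAC subrr add0r linearZ /= normrZ => bound.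
have -> : (L d : R) - h^-1 * (f (x + h *: d) - f x)
          = - (h^-1 * (f (x + h *: d) - f x - h *: L d)).
  by rewrite /GRing.scale /= [in RHS]mulrBr mulrA mulVf // mul1r opprB.
rewrite normrN normrM normfV ler_pdivrMl ?normr_gt0 //.
apply: (le_trans bound); rewrite mulrCA ler_wpM2l // mulrAC ler_pdivrMr //.
by rewrite ler_wpM2l ?(ltW e0) // lerDr.
Qed.

(* Makes limits along a coordinate direction unique, also at boundary profiles:
   on a nondegenerate interval at least one of the two directions is feasible. *)
Lemma profiles_line_proper {R : realType} {N : nat} {G : game R N}
    (x : 'rV[R]_N) (j : 'I_N) :
  strategies_nondegenerate G -> profiles G x ->
  ProperFilter (within [set h | profiles G (x + h *: delta_mx 0 j)] (0 : R)^').
Proof.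
move=> hS px; apply: Build_ProperFilter_ex => P.
rewrite /within /= => /nbhs_ballP[e /= e0 hP].
have inP h : `|h| < e -> h != 0 -> smin G j <= x 0 j + h <= smax G j -> P h.
  move=> he h0 hj; apply: hP => //=; first by rewrite /ball /= sub0r normrN.
  move=> i; rewrite !mxE eqxx /=.
  have [->|_] := eqVneq i j; first by rewrite mulr1 /strategies /= in_itv.
  by rewrite mulr0 addr0; exact: px.
have := px j; rewrite /strategies /= in_itv /= => /andP[lo hi].
have e2 : 0 < e / 2 by rewrite divr_gt0.
have [xlt|xge] := ltP (x 0 j) (smax G j).
(* The half keeps [h] strictly inside the ball of radius [e]; the second term keeps the moved
   coordinate below its upper bound. *)
- set h := Num.min (e / 2) (smax G j - x 0 j).
  have h0 : 0 < h by rewrite lt_min e2 subr_gt0.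
  have he : h <= e / 2 by rewrite ge_min lexx.
  have hx : h <= smax G j - x 0 j by rewrite ge_min lexx orbT.
  exists h; apply: inP; rewrite ?gt_eqF ?gtr0_norm //; first lra.
  by apply/andP; split; lra.
(* Here the coordinate sits at the upper end, so nondegeneracy leaves room to move down. *)
- set h := Num.min (e / 2) (x 0 j - smin G j).
  have h0 : 0 < h by rewrite lt_min e2 subr_gt0 (lt_le_trans (hS j)).
  have he : h <= e / 2 by rewrite ge_min lexx.
  have hx : h <= x 0 j - smin G j by rewrite ge_min lexx orbT.
  exists (- h); apply: inP; rewrite ?oppr_eq0 ?gt_eqF ?normrN ?gtr0_norm //.
    lra.
  by apply/andP; split; lra.
Qed.

Lemma partial_in_profiles {R : realType} {N : nat} {G : game R N}
    (f : 'rV[R]_N -> R) (x : 'rV[R]_N) (L : {linear 'rV[R]_N -> R^o})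
    (j : 'I_N) :
  strategies_nondegenerate G -> profiles G x ->
  has_derivative_in (profiles G) f x L ->
  partial_in (profiles G) f x j = L (delta_mx 0 j).
Proof.
move=> hS px dfL; have PF := profiles_line_proper x j hS px.
by apply: cvg_lim => //; exact: has_derivative_in_cvg.
Qed.

(** [deviate] overwrites coordinate [i], so a shift of that coordinate leaves the set of best
    responses as it was. *)
Lemma BR_own_coordinate {R : realType} {N : nat} {G : game R N}
    (i : 'I_N) (x : 'rV[R]_N) (h : R) :
  BR G i (x + h *: delta_mx 0 i) = BR G i x.
Proof.
rewrite /BR; congr get; rewrite /best_responses.
have -> // : deviate (x + h *: delta_mx 0 i) i = deviate x i.
apply/funext => b; apply/rowP => j; rewrite !mxE eqxx /=.
by case: (j == i); rewrite ?mulr0 ?addr0.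
Qed.

(** The difference quotient is identically zero. This reconciles the true derivative with the zero
    that [JBR] puts on its diagonal by definition. *)
Lemma partial_BR_own {R : realType} {N : nat} {G : game R N}
    (i : 'I_N) (x : 'rV[R]_N) :
  strategies_nondegenerate G -> profiles G x ->
  partial_in (profiles G) (BR G i) x i = 0.
Proof.
move=> hS px; have PF := profiles_line_proper x i hS px.
rewrite /partial_in; under eq_fun do rewrite BR_own_coordinate subrr mulr0.
by apply: cvg_lim => //; exact: cvg_cst.
Qed.

(** The coordinate term is linear and adds no error, so the error of [f] is merely scaled by [k].
    The formula for [L'] is kept for evaluation at basis vectors. *)
Lemma has_derivative_in_comb {R : realType} {N : nat} (D : set 'rV[R]_N)
    (f : 'rV[R]_N -> R) (x : 'rV[R]_N) (L : {linear 'rV[R]_N -> R^o})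
    (i : 'I_N) (k : R) :
  has_derivative_in D f x L ->
  exists2 L' : {linear 'rV[R]_N -> R^o},
    forall v, L' v = (1 - k) * v 0 i + k * L v &
    has_derivative_in D (fun y => (1 - k) * y 0 i + k * f y) x L'.
Proof.
move=> dfL.
pose l (v : 'rV[R]_N) : R^o := (1 - k) * v 0 i + k * L v.
have l_lin : linear l.
  move=> a u v; rewrite /l linearP !mxE /GRing.scale /=; ring.
pose lL := GRing.isLinear.Build R 'rV[R]_N R^o *:%R l l_lin.
pose L' : {linear 'rV[R]_N -> R^o} := HB.pack l lL.
exists L' => // e e0.
have c0 : 0 < 1 + `|k| by rewrite ltr_pwDl.
have := dfL _ (divr_gt0 e0 c0); apply: filterS => y bound.
have -> : (1 - k) * y 0 i + k * f y - ((1 - k) * x 0 i + k * f x) - L' (y - x)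
          = k * (f y - f x - L (y - x)).
  rewrite /L' /= /l !mxE; ring.
rewrite normrM; apply: (le_trans (ler_wpM2l (normr_ge0 k) bound)).
rewrite mulrA ler_wpM2r // mulrCA ler_piMr ?(ltW e0) //.
by rewrite ler_pdivrMr // mul1r lerDr.
Qed.

(** At equilibrium the player's own coordinate is a best response, and single-valuedness forces
    [get] to choose it. *)
Lemma BR_nash {R : realType} {N : nat} {G : game R N} (x : 'rV[R]_N)
    (i : 'I_N) :
  BR_single_valued G -> nash G x -> BR G i x = x 0 i.
Proof.
move=> hsingle [px opt].
have dev_id : deviate x i (x 0 i) = x.
  by apply/rowP => j; rewrite mxE; case: eqP => [->|].
have xi : best_responses G i x (x 0 i).
  by split=> [|a sa]; [exact: px | rewrite dev_id; exact: opt].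
have [b br] := hsingle i x px.
by have := getI xi; rewrite -/(BR G i x); move: xi; rewrite br /= => <-.
Qed.

Lemma damped_row_sum_lt1 {R : realFieldType} (k s : R) :
  0 <= s < 1 -> 0 < k < 2 / (1 + s) -> `|1 - k| + k * s < 1.
Proof.
move=> /andP[s0 s1] /andP[k0]; rewrite ltr_pdivlMr => [ks|]; last lra.
have ks1 : k * s < k by rewrite -[ltRHS]mulr1 ltr_pM2l.
by rewrite mulrDr mulr1 in ks; case: (ger0P (1 - k)) => _; lra.
Qed.

Theorem proposition5 (R : realType) (N : nat) (G : game R N)
    (hS : strategies_nondegenerate G)
    (hcont : own_continuous G) (hconc : own_concave G)
    (hsingle : BR_single_valued G) (hdiff : BR_differentiable G)
    (kappa : nat -> 'I_N -> R) (beta : nat -> 'rV[R]_N)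
    (hplay : JP_play G kappa beta)
    (betaNE : 'rV[R]_N) (hNE : unique_nash G betaNE)
    (hBR : forall (t : nat) (i : 'I_N),
        \sum_(j < N | j != i) `|JBR G (beta t) i j| < 1)
    (hkappa : forall (t : nat) (i : 'I_N),
        0 < kappa t.+1 i
          < 2 / (1 + \sum_(j < N | j != i) `|JBR G (beta t) i j|)) :
  converges_by_contraction G (fun t => JP_map G (kappa t)) beta betaNE.
Proof.
split=> [t|t].
  apply/rowP => i; rewrite mxE BR_nash //; last by case: hNE.
  by rewrite -mulrDl subrK mul1r.
have [/(_ t) px _] := hplay; set x := beta t in px *.
have JP_coord i : (fun y => JP_map G (kappa t.+1) y 0 i)
    = (fun y => (1 - kappa t.+1 i) * y 0 i + kappa t.+1 i * BR G i y).
  by apply/funext => y; rewrite mxE.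
split=> [i|].
  have [L dL] := hdiff i x px.
  have [L' _ dL'] := has_derivative_in_comb _ _ x L i (kappa t.+1 i) dL.
  by rewrite JP_coord; exists L'.
(* The maximum starts from the default 0, which must itself be below 1; then each row is bounded
   separately. *)
apply: bigmax_lt => [|i _]; first exact: ltr01.
have [L dL] := hdiff i x px.
have [L' L'E dL'] := has_derivative_in_comb _ _ x L i (kappa t.+1 i) dL.
have partialBR j := partial_in_profiles _ x L j hS px dL.
(* One formula for all [j]: the derivatives of [JP_map] and [BR] are compared through [L'] and [L],
   and on the diagonal both best-reply terms vanish. *)
have entry j : jacobian_in (profiles G) (JP_map G (kappa t.+1)) x i j
    = (1 - kappa t.+1 i) * (j == i)%:R + kappa t.+1 i * JBR G x i j.
  rewrite !mxE JP_coord (partial_in_profiles _ x L' j hS px dL') L'E.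
  rewrite -partialBR !mxE eqxx /=; case: eqVneq => [->|//].
  by rewrite partial_BR_own.
have /andP[k0 _] := hkappa t i.
have offdiag : \sum_(j < N | j != i)
      `|jacobian_in (profiles G) (JP_map G (kappa t.+1)) x i j|
    = kappa t.+1 i * \sum_(j < N | j != i) `|JBR G x i j|.
  rewrite mulr_sumr; apply: eq_bigr => j ji.
  by rewrite entry (negbTE ji) mulr0 add0r normrM gtr0_norm.
rewrite (bigD1 i) //= offdiag entry eqxx mulr1 mxE eqxx mulr0 addr0.
by apply: damped_row_sum_lt1; rewrite ?hkappa // hBR sumr_ge0.
Qed.
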